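(* Let $\Gamma$ be a finite Abelian group (written additively) and let $\Sigma$ be a generating set of $\Gamma$ consisting of pairwise distinct elements, partitioned as follows: \begin{itemize} \item $r_{\alpha}$ involutions; \item for each $s=1,2,\ldots,m$ (where $m\le k$), $r_s$ elements of order $2s+1$, each together with its inverse; \item $r_{\omega}$ elements of order greater than $2k+1$, each together with its inverse; \item for each $t=2,\ldots,n$ (where $n\le k$), $z_t$ elements of order $t+1$ whose inverses are not in $\Sigma$; \item $z_{\omega}$ elements of order greater than $k+1$ whose inverses are not in $\Sigma$. \end{itemize} Then $\mathrm{Cay}(\Gamma,\Sigma)$ is a mixed graph with undirected degree $r=r_{\alpha}+2r_1+\cdots+2r_m+2r_{\omega}$ and directed out-degree $z=z_2+\cdots+z_n+z_{\omega}$, and if $\mathrm{Cay}(\Gamma,\Sigma)$ has diameter at most $k$, then its number of vertices $N=|\Gamma|$ satisfies $$ N\le \sum_{i_{\alpha}=0}^{r_{\alpha}}\sum_{i_{\omega}=0}^{r_{\omega}}\binom{r_{\alpha}}{i_{\alpha}}\binom{r_{\omega}}{i_{\omega}}2^{i_{\omega}} \sum_{(\sigma_{s,t})}\ \prod_{s=1}^{m}\left[\binom{r_s}{\sigma_{s,1},\ldots,\sigma_{s,s}}2^{\sigma_{s,1}+\cdots+\sigma_{s,s}}\right] \sum_{(\tau_{h,t})}\ \prod_{h=2}^{n}\binom{z_h}{\tau_{h,1},\ldots,\tau_{h,h}} \binom{z_{\omega}+k-i_{\alpha}-\sum_{s=1}^{m}\sum_{t=1}^{s}t\,\sigma_{s,t}-\sum_{h=2}^{n}\sum_{t=1}^{h}t\,\tau_{h,t}}{i_{\omega}+z_{\omega}},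 $$ where the sum over $(\sigma_{s,t})$ runs over all families of nonnegative integers $\sigma_{s,t}$ ($1\le s\le m$, $1\le t\le s$) with $\sum_{t=1}^{s}\sigma_{s,t}\le r_s$ for each $s$, and the sum over $(\tau_{h,t})$ runs over all families of nonnegative integers $\tau_{h,t}$ ($2\le h\le n$, $1\le t\le h$) with $\sum_{t=1}^{h}\tau_{h,t}\le z_h$ for each $h$.
   Context: For an Abelian group $\Gamma$ and generating set $\Sigma$, the Cayley graph $\mathrm{Cay}(\Gamma,\Sigma)$ has vertex set $\Gamma$ and an arc from $g$ to $g+a$ for each $g\in\Gamma$, $a\in\Sigma$; a pair of opposite arcs (arising when $a,-a\in\Sigma$, or $a$ an involution) is regarded as an undirected edge, so the result is a mixed graph (with both edges and arcs). The undirected degree counts edges at a vertex and the directed out-degree counts outgoing arcs that are not part of an edge. The distance from $u$ to $v$ is the length of a shortest directed path (edges traversable in both directions) from $u$ to $v$, and the diameter is the maximum distance over all ordered pairs. The multinomial coefficient is $\binom{r}{a_1,\ldots,a_q}=\frac{r!}{a_1!\cdots a_q!\,(r-a_1-\cdots-a_q)!}$ for nonnegative integers with $a_1+\cdots+a_q\le r$. The binomial coefficient $\binom{a}{b}$ is taken to be $0$ whenever $a<b$ (including negative $a$). *)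

(* Defs.v *)
From HB Require Import structures.
From mathcomp Require Import all_boot all_order all_algebra all_fingroup.

Set Implicit Arguments.
Unset Strict Implicit.
Unset Printing Implicit Defensive.

Import GRing.Theory.

Record mixed_graph (T : finType) := MixedGraph {
  edge : rel T;
  arc : rel T;
  edge_sym : symmetric edge;
  arc_asym : forall u v, arc u v -> ~~ arc v u;
  edge_arc_disjoint : forall u v, ~~ (edge u v && arc u v)
}.

Section MixedGraphs.
Variables (T : finType) (D : mixed_graph T).

Definition undirected_degree (u : T) : nat := #|[set v | edge D u v]|.

Definition directed_outdegree (u : T) : nat := #|[set v | arc D u v]|.

Definition dipath (u v : T) (p : seq T) : bool :=
  [&& path (fun x y => edge D x y || arc D x y) u p,
      uniq (u :: p) & last u p == v].

(* A path has at most #|T|.-1 steps; the value is #|T| exactly when v cannot be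
   reached from u (which does not happen when the graph is a Cayley graph of a
   generating set). *)
Definition dist (u v : T) : nat :=
  find (fun l => [exists p : l.-tuple T, dipath u v p]) (iota 0 #|T|).

Definition diameter : nat := \max_(u : T) \max_(v : T) dist u v.

End MixedGraphs.

Section Cayley.
Variables (G : finZmodType) (Sigma : {set G}).
Local Open Scope ring_scope.

Definition cay_step : rel G := fun g h => h - g \in Sigma.

Definition cay_edge : rel G := fun g h => cay_step g h && cay_step h g.

Definition cay_arc : rel G := fun g h => cay_step g h && ~~ cay_step h g.

Lemma cay_edge_sym : symmetric cay_edge.
Proof. by move=> g h; rewrite /cay_edge andbC. Qed.

Lemma cay_arc_asym g h : cay_arc g h -> ~~ cay_arc h g.
Proof. by rewrite /cay_arc => /andP[-> _]; rewrite andbF. Qed.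

Lemma cay_edge_arc_disjoint g h : ~~ (cay_edge g h && cay_arc g h).
Proof. by rewrite /cay_edge /cay_arc; case: cay_step; case: cay_step. Qed.

Definition Cay : mixed_graph G :=
  MixedGraph cay_edge_sym cay_arc_asym cay_edge_arc_disjoint.

Definition opp_set (B : {set G}) : {set G} := [set - a | a in B].

End Cayley.

(* R s and Rw hold one element of each pair {a, -a}.  The two disjointness
   clauses say that the elements listed with their inverses are distinct; all
   the other blocks are disjoint because of the orders of their elements and of
   whether the opposites belong to Sigma. *)
Record generator_partition (G : finZmodType) (Sigma : {set G}) (k m n : nat)
    (A : {set G}) (R : nat -> {set G}) (Rw : {set G})
    (Z : nat -> {set G}) (Zw : {set G}) : Prop := GeneratorPartition {
  gp_cover : Sigma =
    A :|: (\bigcup_(1 <= s < m.+1) (R s :|: opp_set (R s)))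
      :|: (Rw :|: opp_set Rw)
      :|: (\bigcup_(2 <= t < n.+1) Z t) :|: Zw;
  gp_A : forall a, a \in A -> #[a]%g = 2;
  gp_R : forall s a, 1 <= s <= m -> a \in R s -> #[a]%g = (2 * s).+1;
  gp_R_disjoint : forall s, 1 <= s <= m -> [disjoint R s & opp_set (R s)];
  gp_Rw : forall a, a \in Rw -> (2 * k).+1 < #[a]%g;
  gp_Rw_disjoint : [disjoint Rw & opp_set Rw];
  gp_Z : forall t a, 2 <= t <= n -> a \in Z t ->
    #[a]%g = t.+1 /\ (- a)%R \notin Sigma;
  gp_Zw : forall a, a \in Zw -> k.+1 < #[a]%g /\ (- a)%R \notin Sigma
}.

Definition multinomial (q r : nat) (a : 'I_q -> nat) : nat :=
  r`! %/ ((\prod_(i < q) (a i)`!) * (r - \sum_(i < q) a i)`!).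

(* 'C(a, b) for a possibly negative integer a, with value 0 when a < 0. *)
Definition binz (a : int) (b : nat) : nat :=
  if a is Posz a' then 'C(a', b) else 0.

(* The families (x_{s,t}), lo <= s <= hi, 1 <= t <= s, with 0 <= x_{s,t} <= c s:
   x_{s,t} is f i j with s = lo + i and t = j + 1. *)
Definition families (lo hi : nat) (c : nat -> nat) : finType :=
  {dffun forall i : 'I_(hi.+1 - lo), {ffun 'I_(lo + i) -> 'I_(c (lo + i)).+1}}.

Section Families.
Variables (lo hi : nat) (c : nat -> nat) (f : families lo hi c).

Definition entry (i : 'I_(hi.+1 - lo)) (j : 'I_(lo + i)) : nat := f i j.

Definition row_sum (i : 'I_(hi.+1 - lo)) : nat := \sum_(j < lo + i) entry j.

Definition admissible : bool := [forall i, row_sum i <= c (lo + i)].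

Definition weight : nat :=
  \sum_(i < hi.+1 - lo) \sum_(j < lo + i) j.+1 * entry j.

End Families.

(* Main.v *)
Require Import Defs.
From HB Require Import structures.
From mathcomp Require Import all_boot all_order all_algebra all_fingroup.
From mathcomp Require Import zify.

Set Implicit Arguments.
Unset Strict Implicit.
Unset Printing Implicit Defensive.

Import GRing.Theory.

(** Every element of [G] is a sum of at most [k] generators.  Collecting equal
    generators, it is determined by a coefficient in {0, 1} for each involution,
    in [-s, s] for each pair of opposite generators of order 2s+1, in [0, t] for
    each one-way generator of order t+1, and by unbounded coefficients (integers,
    resp. natural numbers) for the remaining ones, with total absolute value at
    most [k].  Choices of the bounded coefficients are counted by binomial and
    multinomial coefficients; once they are fixed at total cost [c], the
    unbounded part lies in a ball of radius [k - c], which has at most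
    sum_i 'C(rw, i) 2^i 'C(zw + k - c, i + zw) elements by the hockey-stick
    identity. *)

(** * Sums, unions and binomial coefficients *)

Lemma leq_card_bigcup (I T : finType) (P : pred I) (F : I -> {set T}) :
  #|\bigcup_(i | P i) F i| <= \sum_(i | P i) #|F i|.
Proof.
elim/big_rec2: _ => [|i n A _ leAn]; first by rewrite cards0.
by rewrite (leq_trans (leq_card_setU _ _)) ?leq_add2l.
Qed.

(** Hockey-stick identity, by Pascal's rule. The bound [z <= p] makes the right-hand side vanish for
    the empty sum. *)
Lemma sum_bin_shift z n p : z <= p -> \sum_(i < n) 'C(z + i, p) = 'C(z + n, p.+1).
Proof.
move=> le_zp; elim: n => [|n IHn]; first by rewrite big_ord0 addn0 bin_small.
by rewrite big_ord_recr /= IHn addnS binS.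
Qed.

Lemma big_option (R : Type) (idx : R) (op : Monoid.com_law idx) (T : finType)
    (F : option T -> R) :
  \big[op/idx]_x F x = op (F None) (\big[op/idx]_x F (Some x)).
Proof.
rewrite (bigD1 None) //=; congr (op _ _).
rewrite (reindex_omap (@Some T) id) //=; last by case.
by apply: eq_bigl => x; rewrite eqxx.
Qed.

(** * Words with prescribed numbers of letters of each colour *)

Section Words.
Variables (T U : finType) (f : T -> U).

Definition letter_count n (t : n.-tuple T) u := count (fun x => f x == u) t.

Definition words n (c : U -> nat) :=
  [set t : n.-tuple T | [forall u, letter_count t u == c u]].

(** Words are sorted by their first letter [x]. The guard is needed because truncated subtraction
    would leave a zero count unchanged after [x] has been removed. *)
Lemma card_words_rec n (c : U -> nat) :
  #|words n.+1 c| =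
  \sum_x (if 0 < c (f x) then #|words n (fun u => c u - (f x == u))| else 0).
Proof.
rewrite -sum1dep_card.
rewrite (reindex (fun p : T * n.-tuple T => [tuple of p.1 :: p.2])) /=; last first.
  exists (fun t => (thead t, [tuple of behead t])) => [[x t] _ | t _] /=.
    by congr (_, _); apply: val_inj.
  by rewrite -tuple_eta.
rewrite -(pair_big_dep xpredT
  (fun x (t : n.-tuple T) => [forall u, letter_count [tuple of x :: t] u == c u])
  (fun _ _ => 1)) /=.
apply: eq_bigr => x _; case: posnP => [c0|c_gt0].
  rewrite big_pred0 // => t; apply/negP => /forallP/(_ (f x)).
  by rewrite /letter_count /= c0 eqxx.
rewrite sum1dep_card; apply: eq_card => t; rewrite !inE.
apply: eq_forallb => u; rewrite /letter_count /=.
case: (f x =P u) => [<-|_] /=; last by rewrite add0n subn0.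
by rewrite -{1}(prednK c_gt0) subn1.
Qed.

(** The colour pattern is counted by a multinomial coefficient, and each position of colour [u] can
    then be filled by any letter of that colour. The product form avoids division, and induction on
    the first letter proves it. *)
Lemma card_words n (c : U -> nat) : \sum_u c u = n ->
  #|words n c| * \prod_u (c u)`! = n`! * \prod_u #|[set x | f x == u]| ^ c u.
Proof.
elim: n c => [|n IHn] c sum_c.
  have c0 u : c u = 0.
    by apply/eqP; move/eqP: sum_c; rewrite sum_nat_eq0 => /forallP/(_ u).
  rewrite fact0 !big1 => [|u _|u _]; rewrite ?c0 ?fact0 //.
  rewrite (_ : words 0 c = setT) ?cardsT ?card_tuple //.
  by apply/setP => t; rewrite !inE tuple0; apply/forallP => u; rewrite c0.
pose e v u := c u - (v == u).
have eE v u : u != v -> e v u = c u.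
  by move=> /negPf nuv; rewrite /e eq_sym nuv subn0.
have sum_e v : 0 < c v -> \sum_u e v u = n.
  move=> cv; move: sum_c; rewrite (bigD1 v) // [in X in _ -> X](bigD1 v) //=.
  rewrite {1}/e eqxx [in X in _ -> X](eq_bigr _ (eE v)) /=; lia.
(* Decrementing the count at [v] changes only the factor at [v]; this serves for both factorials and
   powers. *)
have prodD (F : U -> nat -> nat) v :
    \prod_u F u (c u) * F v (c v).-1 = F v (c v) * \prod_u F u (e v u).
  rewrite (bigD1 v) // [in RHS](bigD1 v) //= {1}/e eqxx subn1.
  rewrite [in RHS](eq_bigr (fun u => F u (c u))) => [|u /eE-> //].
  by rewrite -!mulnA; congr (_ * _); rewrite mulnC.
rewrite card_words_rec big_distrl /=.
pose M v := #|[set x | f x == v]|.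
rewrite (partition_big f xpredT) //=.
(* First letters of colour [v] contribute a share proportional to [c v]; these shares add up to the
   missing factor n + 1 of the factorial. *)
transitivity (\sum_v c v * (n`! * \prod_u M u ^ c u)); last first.
  by rewrite -big_distrl /= sum_c factS mulnA.
apply: eq_bigr => v _.
rewrite (eq_bigr (fun _ => c v * (n`! * \prod_u M u ^ e v u))).
  rewrite big_const iter_addn_0 -/(M v).
  have -> : #|[pred x | f x == v]| = M v by rewrite /M cardsE.
  case: (posnP (c v)) => [->|cv]; first by rewrite !mul0n.
  have := prodD (fun u a => M u ^ a) v => /=.
  (* The factor [M v] cannot be cancelled when no letter has colour [v], but then both sides vanish
     since [c v > 0]. *)
  case: (posnP (M v)) => [M0|M_gt0].
    rewrite M0 muln0 (bigD1 v) //= M0 exp0n // mul0n !muln0 //.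
  have -> : M v ^ c v = M v * M v ^ (c v).-1 by rewrite -expnS prednK.
  rewrite -mulnA [RHS]mulnCA mulnC => /eqP.
  rewrite eqn_pmul2l ?expn_gt0 ?M_gt0 // => /eqP ->.
  by rewrite -!mulnA; congr (_ * (_ * _)); rewrite mulnC.
move=> x /eqP fx; rewrite fx; case: posnP => [->|cv]; first by rewrite !mul0n.
have := IHn (e v) (sum_e v cv); rewrite -/M => <-.
have := prodD (fun _ a => a`!) v => /=.
have -> : (c v)`! = c v * (c v).-1`! by rewrite -{1}(prednK cv) factS prednK.
rewrite -mulnA [RHS]mulnCA mulnC => /eqP; rewrite eqn_pmul2l ?fact_gt0 // => /eqP ->.
by rewrite mulnCA.
Qed.

End Words.

(** * Bounded coefficients and multinomial coefficients *)

Section Levels.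
Variable B : finType.

Definition level q (x : option ('I_q * B)) : option 'I_q := omap fst x.

(** [None] codes the coefficient 0 and [Some (j, b)] one of absolute value j + 1 with sign [b]. The
    type [B] is [bool] for pairs of opposite generators and [unit] for one-way generators. *)
Definition code_cost q (x : option ('I_q * B)) : nat :=
  if x is Some p then p.1.+1 else 0.

Definition level_count q r (y : {ffun 'I_r -> option ('I_q * B)}) j : nat :=
  \sum_(u < r) (level (y u) == Some j).

Lemma sum_level_count q r (y : {ffun 'I_r -> option ('I_q * B)}) :
  \sum_j level_count y j <= r.
Proof.
rewrite exchange_big /= -[X in _ <= X]card_ord -sum1_card leq_sum // => u _.
case: (level (y u)) => [j0|]; last by rewrite big1.
by rewrite (bigD1 j0) //= eqxx big1 // => j /negPf nj; rewrite eqE /= eq_sym nj.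
Qed.

Lemma level_count_le q r (y : {ffun 'I_r -> option ('I_q * B)}) j :
  level_count y j <= r.
Proof. by apply: leq_trans (sum_level_count y); rewrite (bigD1 j) //= leq_addr. Qed.

Lemma sum_code_cost q r (y : {ffun 'I_r -> option ('I_q * B)}) :
  \sum_u code_cost (y u) = \sum_(j < q) j.+1 * level_count y j.
Proof.
under [RHS]eq_bigr do rewrite big_distrr /=.
rewrite exchange_big /=; apply: eq_bigr => u _.
case: (y u) => [[j0 b]|] /=; last by rewrite big1 // => j _; rewrite muln0.
rewrite (bigD1 j0) //= eqxx muln1 big1 ?addn0 // => j /negPf nj.
by rewrite eqE /= eq_sym nj muln0.
Qed.

(** Such a [y] is a word of length [r] coloured by levels, in which [None] fills the remaining
    places. The colour [None] has one letter and every other colour has #|B| letters. *)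
Lemma card_level_count q r (a : 'I_q -> nat) : \sum_j a j <= r ->
  #|[set y : {ffun 'I_r -> option ('I_q * B)} |
      [forall j, level_count y j == a j]]| =
  multinomial r a * #|B| ^ (\sum_j a j).
Proof.
move=> le_a_r; pose c (o : option 'I_q) := if o is Some j then a j else r - \sum_j a j.
have sum_c : \sum_o c o = r by rewrite big_option /= subnK.
have prod_c : \prod_o (c o)`! = (\prod_j (a j)`!) * (r - \sum_j a j)`!.
  by rewrite big_option /= mulnC.
have prodc_gt0 : 0 < \prod_o (c o)`! by rewrite prodn_gt0 // => o; rewrite fact_gt0.
(* With the identity colouring every colour has one letter, so [card_words] shows that the division
   defining the multinomial coefficient is exact. *)
have dvd_c : \prod_o (c o)`! %| r`!.
  have := card_words (@id (option (ordinal q))) sum_c.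
  rewrite [X in r`! * X]big1 ?muln1 => [<-|o _]; first exact: dvdn_mull.
  rewrite (_ : [set x | x == o] = [set o]) ?cards1 ?exp1n //.
  by apply/setP=> x; rewrite !inE.
have <- : #|words (@level q) r c| = #|[set y : {ffun 'I_r -> option ('I_q * B)} |
      [forall j, level_count y j == a j]]|.
  rewrite -(card_imset _ (can_inj (@finfun_of_tupleK _ _))) /=.
  apply: eq_card => y; rewrite -[y]tuple_of_finfunK.
  rewrite (mem_imset _ _ (can_inj (@finfun_of_tupleK _ _))).
  set t := tuple_of_finfun y; rewrite !inE.
  have cntE o : letter_count (@level q) t o =
      \sum_(u < r) (level (finfun_of_tuple t u) == o).
    rewrite /letter_count -sum1_count big_tuple big_mkcond /=.
    by apply: eq_bigr => u _; rewrite ffunE; case: eqP.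
  apply/forallP/forallP => [h j|h [j|]]; first by rewrite /level_count -cntE h.
    by rewrite cntE; exact: h.
  (* The count of [None] is forced: all counts together add up to [r]. *)
  rewrite -(eqn_add2r (\sum_j letter_count (@level q) t (Some j))).
  rewrite -[X in X == _](big_option _ (letter_count (@level q) t)) /=.
  have -> : \sum_j letter_count (@level q) t (Some j) = \sum_j a j.
    by apply: eq_bigr => j _; rewrite cntE; apply/eqP/h.
  rewrite subnK //; under eq_bigr do rewrite cntE.
  rewrite exchange_big /= -[X in _ == X]card_ord -sum1_card; apply/eqP/eq_bigr => u _.
  rewrite (bigD1 (level (finfun_of_tuple t u))) //= eqxx big1 // => o.
  by rewrite eq_sym => /negPf->.
have := card_words (@level q) sum_c.
rewrite [X in r`! * X]big_option /=.
have -> : [set x | level x == None] = [set (None : option ('I_q * B))].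
  by apply/setP => -[[j b]|]; rewrite !inE.
rewrite cards1 exp1n mul1n.
rewrite [X in r`! * X](eq_bigr (fun j => #|B| ^ a j)) => [|j _]; last first.
  congr (_ ^ _).
  have Ej : injective (fun b : B => Some (j, b)) by move=> b b' [].
  rewrite -cardsT -(card_imset _ Ej); apply: eq_card => -[[j' b]|]; rewrite !inE /=.
    apply/eqP/imsetP => [[->]|[b' _ [-> _]] //]; by exists b.
  by symmetry; apply/negP => /imsetP[].
rewrite -expn_sum => E; apply/eqP; rewrite -(eqn_pmul2r prodc_gt0) E.
by rewrite /multinomial -prod_c mulnAC divnK.
Qed.

(** Codes are grouped by their level counts, which form an admissible family and determine the cost.
    In each group the rows are chosen independently, whence the product over rows. *)
Lemma sum_families lo hi (c : nat -> nat) (F : nat -> nat) :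
  \sum_(x : {dffun forall i : 'I_(hi.+1 - lo),
                     {ffun 'I_(c (lo + i)) -> option ('I_(lo + i) * B)}})
     F (\sum_i \sum_u code_cost (x i u)) =
  \sum_(sigma : families lo hi c | admissible sigma)
     (\prod_(s < hi.+1 - lo) (multinomial (c (lo + s)) (entry sigma (i := s)) *
         #|B| ^ row_sum sigma s)) * F (weight sigma).
Proof.
pose lv (x : {dffun forall i : 'I_(hi.+1 - lo),
             {ffun 'I_(c (lo + i)) -> option ('I_(lo + i) * B)}}) : families lo hi c :=
  [ffun i => [ffun j => inord (level_count (x i) j)]].
(* No level count exceeds the length of its row, so [inord] does not fall back on its default
   value. *)
have lvE x i j : entry (lv x) (i := i) j = level_count (x i) j.
  by rewrite /entry /lv !ffunE inordK // ltnS level_count_le.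
rewrite (partition_big lv (@admissible lo hi c)) => [|x _]; last first.
  apply/forallP => i; rewrite /row_sum.
  by rewrite (eq_bigr _ (fun j _ => lvE x i j)) sum_level_count.
apply: eq_bigr => sigma /forallP adm.
rewrite (eq_bigr (fun _ => F (weight sigma))) => [|x /eqP <-]; last first.
  congr F; apply: eq_bigr => i _; rewrite sum_code_cost.
  by apply: eq_bigr => j _; rewrite lvE.
rewrite big_const iter_addn_0 mulnC; congr (_ * _).
pose Y (i : 'I_(hi.+1 - lo)) :=
  [set y : {ffun 'I_(c (lo + i)) -> option ('I_(lo + i) * B)} |
               [forall j, level_count y j == entry sigma (i := i) j]].
transitivity #|(family (fun i => mem (Y i)) :
  simpl_pred {dffun forall i : 'I_(hi.+1 - lo),
             {ffun 'I_(c (lo + i)) -> option ('I_(lo + i) * B)}})|.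
  apply: eq_card => x.
  apply/(@eqP (families lo hi c) (lv x) sigma)/familyP => [lvx i|hx].
    by rewrite inE; apply/forallP => j; rewrite -lvx lvE.
  apply/ffunP => i; apply/ffunP => j; apply: val_inj.
  rewrite -[LHS]/(entry (lv x) j) lvE.
  by move: (hx i); rewrite inE => /forallP/(_ j)/eqP.
rewrite card_family foldrE big_map big_enum /=; apply: eq_bigr => i _.
exact: card_level_count (adm i).
Qed.

End Levels.

(** Boolean functions are grouped by the size of the subset that they indicate. *)
Lemma sum_ffun_bool n (F : nat -> nat) :
  \sum_(x : {ffun 'I_n -> bool}) F (\sum_i x i) = \sum_(i < n.+1) 'C(n, i) * F i.
Proof.
rewrite (partition_big
  (fun x : {ffun 'I_n -> bool} => inord (\sum_i x i) : 'I_n.+1) xpredT) //=.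
have le_n (x : {ffun 'I_n -> bool}) : \sum_i x i <= n.
  by rewrite -[X in _ <= X]card_ord -sum1_card leq_sum // => i _; case: (x i).
apply: eq_bigr => i _; rewrite (eq_bigr (fun _ => F i)) => [|x /eqP <-]; last first.
  by rewrite inordK // ltnS.
rewrite big_const iter_addn_0 mulnC; congr (_ * _).
pose g (x : {ffun 'I_n -> bool}) := [set j | x j].
have g_inj : injective g.
  by move=> x y /setP gxy; apply/ffunP => j; move: (gxy j); rewrite !inE.
have := card_draws 'I_n i; rewrite card_ord => <-; rewrite -(card_imset _ g_inj).
have card_g x : #|g x| = \sum_j x j.
  by rewrite -sum1dep_card big_mkcond /=; apply: eq_bigr => j _; case: (x j).
apply: eq_card => X; apply/imsetP/idP => [[x /(@eqP 'I_n.+1) xi ->]|]; rewrite inE.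
  by rewrite card_g -xi inordK // ltnS le_n.
move=> cX; exists [ffun j => j \in X]; last by apply/setP => j; rewrite inE ffunE.
apply/(@eqP 'I_n.+1)/val_inj; rewrite /= inordK ?ltnS ?le_n // -card_g -(eqP cX).
by apply: eq_card => j; rewrite inE ffunE.
Qed.

Local Open Scope ring_scope.

(** * Codes absorbing generators at unit price *)

Section Covers.
Variable G : zmodType.

(* [x : X] codes the group element [phi x], and every letter of [S] can be
   added to a coded element at the price of at most one unit of cost. *)
Definition covers (X : Type) (phi : X -> G) (cost : X -> nat) (S : G -> Prop) :=
  (exists2 x, phi x = 0 & cost x = 0%N) /\
  forall x a, S a -> exists2 y, phi y = phi x + a & (cost y <= (cost x).+1)%N.

(** Only the coordinate responsible for the added letter changes; [dfwith] performs this update. *)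
Lemma covers_dffun (I : finType) (X : I -> Type) (phi : forall i, X i -> G)
    (cost : forall i, X i -> nat) (S : I -> G -> Prop) :
  (forall i, covers (phi i) (cost i) (S i)) ->
  covers (fun x : {ffun forall i, X i} => \sum_i phi i (x i))
    (fun x => \sum_i cost i (x i))%N (fun a => exists i, S i a).
Proof.
move=> cov; split.
  have /fin_all_exists[x0 x0P] i : exists x, phi i x = 0 /\ cost i x = 0%N.
    by have [[x ? ?] _] := cov i; exists x.
  by exists [ffun i => x0 i]; apply: big1 => i _; rewrite ffunE; have [] := x0P i.
move=> x a [i Sia]; have [_ /(_ (x i) a Sia) [y phiy costy]] := cov i.
exists [ffun j => dfwith x y j].
  rewrite (bigD1 i) // [in RHS](bigD1 i) //= ffunE dfwith_in phiy addrAC.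
  congr (_ + _ + _); apply: eq_bigr => j nji.
  by rewrite ffunE dfwith_out // eq_sym.
rewrite (bigD1 i) // [in X in (_ <= X)%N](bigD1 i) //= ffunE dfwith_in -addSn.
rewrite leq_add // leq_sum // => j nji.
by rewrite ffunE dfwith_out // eq_sym.
Qed.

Lemma covers_prod (X Y : Type) (phi : X -> G) (psi : Y -> G) cX cY S T :
  covers phi cX S -> covers psi cY T ->
  covers (fun p : X * Y => phi p.1 + psi p.2) (fun p => cX p.1 + cY p.2)%N
    (fun a => S a \/ T a).
Proof.
move=> [[x0 px0 cx0] stepX] [[y0 py0 cy0] stepY]; split.
  by exists (x0, y0); rewrite /= ?px0 ?py0 ?addr0 ?cx0 ?cy0.
move=> [x y] a /= [/(stepX x)[x' px' cx']|/(stepY y)[y' py' cy']].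
  by exists (x', y); rewrite /= ?px' 1?addrAC // -addSn leq_add2r.
by exists (x, y'); rewrite /= ?py' ?addrA // -addnS leq_add2l.
Qed.

Lemma covers_sub (X : Type) (phi : X -> G) cost (S T : G -> Prop) :
  (forall a, T a -> S a) -> covers phi cost S -> covers phi cost T.
Proof. by move=> TS [h0 h1]; split=> // x a /TS/(h1 x). Qed.

Lemma covers_involution (a : G) : a *+ 2 = 0 ->
  covers (fun b : bool => a *+ b) nat_of_bool (eq a).
Proof.
move=> a2; split; first by exists false.
by move=> [] _ <-; [exists false | exists true]; rewrite //= ?add0r // -mulr2n a2.
Qed.

Definition cyclic_value (a : G) t (x : option ('I_t * unit)) : G :=
  if x is Some p then a *+ p.1.+1 else 0.

(** The coded multiples run from 0 to [t]; one step beyond [t] wraps around to 0, whose cost is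
    0. *)
Lemma covers_cyclic (a : G) t : (0 < t)%N -> a *+ t.+1 = 0 ->
  covers (@cyclic_value a t) (@code_cost _ t) (eq a).
Proof.
move=> t_gt0 at0; split; first by exists None.
move=> [[j []]|] _ <- /=; last by exists (Some (Ordinal t_gt0, tt)); rewrite /= ?add0r.
have [ltjt|letj] := ltnP j.+1 t.
  by exists (Some (Ordinal ltjt, tt)); rewrite //= -mulrSr.
exists None => //=; rewrite -mulrSr.
by have -> : j.+2 = t.+1 by have := ltn_ord j; lia.
Qed.

Definition signed_value (a : G) s (x : option ('I_s * bool)) : G :=
  if x is Some p then (if p.2 then a else - a) *+ p.1.+1 else 0.

(** The coefficients from -s to s represent all residues modulo 2s + 1, and a step either moves by
    one or wraps from one end to the other. *)
Lemma covers_signed (a : G) s : (0 < s)%N -> a *+ (2 * s).+1 = 0 ->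
  covers (@signed_value a s) (@code_cost _ s) (fun b => b = a \/ b = - a).
Proof.
move=> s_gt0 as0; split; first by exists None.
move=> x c Sc; pose g (e : bool) := if e then a else - a.
have [e ->] : exists e, c = g e by case: Sc => ->; [exists true | exists false].
have gN b : g (~~ b) = - g b by case: b; rewrite /= ?opprK.
have gs0 b : g b *+ (2 * s).+1 = 0 by case: b; rewrite /= ?mulNrn as0 ?oppr0.
case: x => [[j b]|] /=; last first.
  by exists (Some (Ordinal s_gt0, e)); rewrite /= ?add0r.
rewrite -/(g b); have [<-|neb] := eqVneq b e.
  have [ltjs|lesj] := ltnP j.+1 s.
    by exists (Some (Ordinal ltjs, b)); rewrite //= -mulrSr.
  (* Here j + 1 = s, and s + 1 is congruent to -s, so the sign flips and the cost stays [s]. *)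
  exists (Some (j, ~~ b)) => //=; rewrite -/(g _) gN -mulrSr mulNrn.
  apply/eqP; rewrite eq_sym -subr_eq0 opprK -mulrnDr.
  have -> : (j.+2 + j.+1 = (2 * s).+1)%N by have := ltn_ord j; lia.
  by rewrite gs0.
have -> : g e = - g b by rewrite -gN; congr g; case: (b) (e) neb => [] [].
(* A step of opposite sign lowers the absolute value by one; absolute value 1 becomes [None]. *)
case: j => [[|j] ltj] /=; first by exists None; rewrite //= mulr1n subrr.
exists (Some (Ordinal (ltnW ltj), b)) => /=; last by lia.
by rewrite [in RHS]mulrSr addrK.
Qed.

End Covers.

(** * Balls for the unbounded coefficients *)

Section Balls.
Variable G : finZmodType.

Fixpoint positive_ball (P : seq G) (K : nat) : {set G} :=
  if P is b :: P' then
    \bigcup_(i < K.+1) [set b *+ i + x | x in positive_ball P' (K - i)]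
  else [set 0].

(** The coefficients on [L] are integers and those on [P] natural numbers. The coefficient 0 of [a]
    has a piece of its own, so that the bound on the cardinality does not count it once per sign. *)
Fixpoint ball (L P : seq G) (K : nat) : {set G} :=
  if L is a :: L' then
    ball L' P K
      :|: \bigcup_(i < K) [set a *+ i.+1 + x | x in ball L' P (K - i.+1)]
      :|: \bigcup_(i < K) [set - a *+ i.+1 + x | x in ball L' P (K - i.+1)]
  else positive_ball P K.

Lemma card_positive_ball P K :
  (#|positive_ball P K| <= 'C(size P + K, size P))%N.
Proof.
elim: P K => [|b P IHP] K /=; first by rewrite cards1 bin0.
apply: leq_trans (leq_card_bigcup _ _) _.
rewrite addSnnS -sum_bin_shift //.
rewrite (reindex_inj rev_ord_inj) /= leq_sum // => i _.
rewrite card_imset; last exact: addrI.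
by rewrite subSS subKn ?IHP // -ltnS.
Qed.

(** The index [i] stands for the number of nonzero coefficients on [L]: their places, their signs,
    and then their absolute values together with the coefficients on [P]. *)
Lemma card_ball L P K :
  (#|ball L P K| <=
    \sum_(i < (size L).+1) 'C(size L, i) * 2 ^ i * 'C(size P + K, i + size P))%N.
Proof.
elim: L K => [|a L IHL] K.
  by rewrite /= big_ord1 bin0 !mul1n add0n card_positive_ball.
pose F r K := (\sum_(i < r.+1) 'C(r, i) * 2 ^ i * 'C(size P + K, i + size P))%N.
(* Summing over the absolute value of one nonzero coefficient raises the lower binomial index by
   one, by the hockey-stick identity. *)
have shell (b : G) :
    (#|\bigcup_(i < K) [set (b *+ i.+1 + x)%R | x in ball L P (K - i.+1)]|
    <= \sum_(i < (size L).+1) 'C(size L, i) * 2 ^ i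
          * 'C(size P + K, (i + size P).+1))%N.
  apply: leq_trans (leq_card_bigcup _ _) _.
  apply: (@leq_trans (\sum_(j < K) F (size L) (K - j.+1)%N)%N).
    apply: leq_sum => j _; rewrite card_imset; [exact: IHL | exact: addrI].
  rewrite exchange_big /= leq_sum // => i _.
  rewrite -big_distrr /= leq_mul2l -sum_bin_shift ?leq_addl // orbC.
  rewrite (reindex_inj rev_ord_inj) /= leq_sum // => j _.
  by rewrite subnSK // subKn // ltnW.
apply: leq_trans (leq_card_setU _ _) _.
apply: leq_trans (leq_add (leq_card_setU _ _) (leqnn _)) _.
apply: leq_trans (leq_add (leq_add (IHL K) (shell a)) (shell (- a))) _.
rewrite [in X in (_ <= X)%N]/= [X in (_ <= X)%N]big_ord_recl /= bin0 expn0 !mul1n add0n.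
under [X in (_ <= _ + X)%N]eq_bigr => i _ do
  rewrite /bump /= add1n binS !mulnDl expnS !addSn.
(* Pascal's rule has split the right-hand side: one part, with the term of index 0, bounds the piece
   of coefficient 0, and the other bounds the two signed shells. *)
rewrite big_split /= addnA -addnA leq_add //.
  rewrite [X in (_ <= _ + X)%N]big_ord_recr /= (bin_small (ltnSn _)) !mul0n addn0.
  rewrite big_ord_recl /= bin0 expn0 !mul1n add0n leq_add2l leq_sum // => i _.
  by rewrite /bump /= add1n expnS addSn.
rewrite -big_split /= leq_sum // => i _.
by rewrite addnn -mul2n !mulnA leq_mul2r leq_mul2r mulnC leqnn !orbT.
Qed.

Lemma positive_ballP b P K g :
  reflect (exists2 i, (i <= K)%N & g - b *+ i \in positive_ball P (K - i))
    (g \in positive_ball (b :: P) K).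
Proof.
apply: (iffP bigcupP) => [[i _ /imsetP[x xP ->]]|[i leiK gP]].
  by exists i; [rewrite -ltnS | rewrite addrC addKr].
exists (Ordinal (leiK : i < K.+1)%N) => //=; apply/imsetP.
by exists (g - b *+ i); rewrite // addrC subrK.
Qed.

Lemma ball_consP a L P K g :
  reflect (exists e : bool, exists2 i, (i <= K)%N &
             g - (if e then a else - a) *+ i \in ball L P (K - i))
    (g \in ball (a :: L) P K).
Proof.
have shellP b : reflect (exists2 i, (i < K)%N & g - b *+ i.+1 \in ball L P (K - i.+1))
    (g \in \bigcup_(i < K) [set b *+ i.+1 + x | x in ball L P (K - i.+1)]).
  apply: (iffP bigcupP) => [[i _ /imsetP[x xP ->]]|[i ltiK gP]].
    by exists i; rewrite // addrC addKr.
  exists (Ordinal ltiK) => //=; apply/imsetP.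
  by exists (g - b *+ i.+1); rewrite // addrC subrK.
rewrite /= !in_setU -orbA.
apply: (iffP or3P) => [[gK|/shellP[i lti gi]|/shellP[i lti gi]]|].
- by exists true; exists 0%N; rewrite ?mulr0n ?subr0 ?subn0.
- by exists true; exists i.+1.
- by exists false; exists i.+1.
move=> [e [[|i] lti gi]]; first by apply: Or31; move: gi; rewrite mulr0n subr0 subn0.
by case: e gi => gi; [apply: Or32 | apply: Or33]; apply/shellP; exists i.
Qed.

Lemma positive_ball_mono P K K' g : (K <= K')%N ->
  g \in positive_ball P K -> g \in positive_ball P K'.
Proof.
elim: P K K' g => [//|b P IHP] K K' g leK /positive_ballP[i lei gi].
apply/positive_ballP; exists i; first exact: leq_trans leK.
by apply: IHP gi; rewrite leq_sub2r.
Qed.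

Lemma ball_mono L P K K' g : (K <= K')%N -> g \in ball L P K -> g \in ball L P K'.
Proof.
elim: L K K' g => [|a L IHL] K K' g leK; first exact: positive_ball_mono.
move=> /ball_consP[e [i lei gi]].
apply/ball_consP; exists e; exists i; first exact: leq_trans leK.
by apply: IHL gi; rewrite leq_sub2r.
Qed.

Lemma positive_ball0 P K : 0 \in positive_ball P K.
Proof.
elim: P K => [|b P IHP] K; first exact: set11.
by apply/positive_ballP; exists 0%N; rewrite // mulr0n subr0.
Qed.

Lemma ball0 L P K : 0 \in ball L P K.
Proof.
elim: L K => [|a L IHL] K; first exact: positive_ball0.
by apply/ball_consP; exists true; exists 0%N; rewrite // mulr0n subr0.
Qed.

Lemma positive_ballS P K g c :
  c \in P -> g \in positive_ball P K -> g + c \in positive_ball P K.+1.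
Proof.
elim: P K g => [//|b P IHP] K g; rewrite inE => cP /positive_ballP[i lei gi].
apply/positive_ballP; case/predU1P: cP => [->|cP].
  by exists i.+1; rewrite // mulrSr opprD addrACA subrr addr0 subSS.
by exists i; [exact: leqW | rewrite addrAC subSn // IHP].
Qed.

(** If [c] is [a] or its opposite, the coefficient of [a] moves away from 0, which uses the extra
    unit of radius, or towards 0, which frees one. Other letters go to the tail. *)
Lemma ballS L P K g c : [|| c \in L, - c \in L | c \in P] ->
  g \in ball L P K -> g + c \in ball L P K.+1.
Proof.
elim: L K g => [|a L IHL] K g; first exact: positive_ballS.
move=> cLP /ball_consP[e [i lei gi]]; apply/ball_consP.
pose s (b : bool) := if b then a else - a; rewrite -/(s e) in gi.
have [cLP'|] := boolP [|| c \in L, - c \in L | c \in P].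
  by exists e; exists i; [exact: leqW | rewrite addrAC subSn // IHL].
rewrite !negb_or => /and3P[/negPf cL /negPf cL' /negPf cP].
have [b ->] : exists b, c = s b.
  move: cLP; rewrite !inE cL cL' cP !orbF => /orP[]/eqP ca; first by exists true.
  by exists false; rewrite /s -ca opprK.
have [<-|neb] := eqVneq e b.
  by exists e; exists i.+1; rewrite // -/(s e) mulrSr opprD addrACA subrr addr0 subSS.
have -> : s b = - s e by case: (e) (b) neb => [] [] //; rewrite /= ?opprK.
(* The coefficient 0 may carry the wrong sign [e]; the new coefficient then takes the other sign. *)
case: i lei gi => [|i] lei gi.
  exists (~~ e); exists 1%N; rewrite // -/(s (~~ e)).
  have -> : s (~~ e) = - s e by case: (e); rewrite /= ?opprK.
  by rewrite mulr1n addrK subSS; move: gi; rewrite mulr0n subr0.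
exists e; exists i; first by lia.
move: gi; rewrite mulrS opprD addrA; apply: ball_mono; lia.
Qed.

(** Letters are absorbed one at a time, by the code or by the remainder. Each letter adds one to the
    total budget, which pays for either choice. *)
Lemma covers_ball (X : Type) (phi : X -> G) cost S L P (w : seq G) :
  covers phi cost S ->
  {in w, forall c, S c \/ [|| c \in L, - c \in L | c \in P]} ->
  exists2 x, (cost x <= size w)%N &
    \sum_(c <- w) c - phi x \in ball L P (size w - cost x).
Proof.
move=> [[x0 phi0 cost0] step]; elim: w => [|c w IHw] wS.
  by exists x0; rewrite ?cost0 // big_nil phi0 subr0 ball0.
have [|x costx wx] := IHw; first by move=> d dw; apply: wS; rewrite inE dw orbT.
rewrite big_cons /=; case: (wS c (mem_head _ _)) => [/(step x)[y phiy costy]|cLP].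
  exists y; first by lia.
  rewrite phiy opprD [- _ + _]addrC addrACA subrr add0r; apply: ball_mono wx; lia.
exists x; first exact: leqW.
by rewrite subSn // -addrA addrC ballS.
Qed.

End Balls.

(** * Paths and degrees in the Cayley graph *)

Section CayleyWords.
Variables (G : finZmodType) (Sigma : {set G}).

Lemma cay_path_word u p : path (cay_step Sigma) u p ->
  exists w, [/\ size w = size p, {subset w <= Sigma} & last u p = u + \sum_(c <- w) c].
Proof.
elim: p u => [|v p IHp] u /=; first by exists [::]; rewrite big_nil addr0.
case/andP => uv /IHp[w [sw wS ->]]; exists (v - u :: w).
split; rewrite /= ?sw //; last by rewrite big_cons addrA subrKC.
by move=> c; rewrite inE => /predU1P[->|/wS].
Qed.

(** In a finite group the generated subgroup consists of products of generators without inverses, so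
    directed steps suffice. *)
Lemma gen_connect g : <<Sigma>>%g = [set: G] -> connect (cay_step Sigma) 0 g.
Proof.
move=> genS; have : g \in <<Sigma>>%g by rewrite genS inE.
case/gen_prodgP => n [c cS ->]; elim: n c cS => [|n IHn] c cS.
  by rewrite big_ord0 connect0.
rewrite big_ord_recr /=; apply: connect_trans (IHn _ (fun i => cS _)) (connect1 _).
have addK (p d : G) : p + d - p = d by rewrite addrAC subrr add0r.
by rewrite /cay_step (_ : _ - _ = c ord_max) //; apply: addK.
Qed.

Lemma diameter_word k g : <<Sigma>>%g = [set: G] ->
  (diameter (Cay Sigma) <= k)%N ->
  exists w, [/\ (size w <= k)%N, {subset w <= Sigma} & g = \sum_(c <- w) c].
Proof.
move=> genS diamk.
have stepE : (fun x y => edge (Cay Sigma) x y || Defs.arc (Cay Sigma) x y)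
               =2 cay_step Sigma.
  by move=> x y; rewrite /= /cay_edge /cay_arc -andb_orr orbN andbT.
have distk : (dist (Cay Sigma) 0%R g <= k)%N.
  apply: leq_trans diamk; apply: leq_trans (leq_bigmax (0 : G)).
  exact: (@leq_bigmax _ (fun v => dist (Cay Sigma) 0 v)).
pose a l := [exists p : l.-tuple G, dipath (Cay Sigma) 0 g p].
(* The search defining [dist] succeeds: a path without repeated vertices has fewer than #|G|
   steps. *)
have has_a : has a (iota 0 #|G|).
  have /connectP[p pp gE] := gen_connect g genS.
  case: (shortenP pp) gE => q qp qu _ gE.
  apply/hasP; exists (size q).
    by rewrite mem_iota; have := max_card [in 0 :: q]; rewrite (card_uniqP qu).
  apply/existsP; exists (in_tuple q); apply/and3P.
  by rewrite (eq_path stepE) qp qu -gE.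
have := nth_find 0%N has_a; rewrite nth_iota ?add0n; last first.
  by rewrite -[X in (_ < X)%N](size_iota 0) -has_find.
rewrite -/(dist _ _ _) => /existsP[p /and3P[]].
rewrite (eq_path stepE) => /cay_path_word[w [sw wS lw]] _ /eqP gE.
by exists w; split; rewrite // ?sw ?size_tuple // -gE lw add0r.
Qed.

Lemma undirected_degreeE g :
  undirected_degree (Cay Sigma) g = #|[set a in Sigma | - a \in Sigma]|.
Proof.
rewrite /undirected_degree -[RHS](card_imset _ (addrI g)); apply: eq_card => v.
rewrite -[v in RHS](subrKC g v) (mem_imset _ _ (addrI g)) !inE /= /cay_edge /cay_step.
by rewrite opprB.
Qed.

Lemma directed_outdegreeE g :
  directed_outdegree (Cay Sigma) g = #|[set a in Sigma | - a \notin Sigma]|.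
Proof.
rewrite /directed_outdegree -[RHS](card_imset _ (addrI g)); apply: eq_card => v.
rewrite -[v in RHS](subrKC g v) (mem_imset _ _ (addrI g)) !inE /= /cay_arc /cay_step.
by rewrite opprB.
Qed.

End CayleyWords.

(** * The blocks of generators and the degrees *)

Lemma in_bigcup_seq (I : Type) (T : finType) (s : seq I) (F : I -> {set T}) x :
  (x \in \bigcup_(i <- s) F i) = has (fun i => x \in F i) s.
Proof. by elim: s => [|i s IHs]; rewrite ?big_nil ?big_cons inE //= IHs. Qed.

Lemma in_bigcup_nat (T : finType) lo hi (F : nat -> {set T}) x :
  reflect (exists2 i, (lo <= i < hi)%N & x \in F i)
    (x \in \bigcup_(lo <= i < hi) F i).
Proof.
rewrite in_bigcup_seq; apply: (iffP hasP) => [] [i]; rewrite ?mem_index_iota.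
  by exists i.
by exists i; rewrite // mem_index_iota.
Qed.

(** The blocks are disjoint because the label of an element reveals its block; below, the label is
    computed from the order. *)
Lemma card_bigcup_label (I : eqType) (T : finType) (s : seq I)
    (F : I -> {set T}) (label : T -> I) : uniq s ->
  {in s, forall i x, x \in F i -> label x = i} ->
  #|\bigcup_(i <- s) F i| = (\sum_(i <- s) #|F i|)%N.
Proof.
elim: s => [|i s IHs] /=; first by rewrite !big_nil cards0.
case/andP => nis us labelF; rewrite !big_cons -IHs //; last first.
  by move=> j js; apply: labelF; rewrite inE js orbT.
apply/eqP; rewrite (leq_card_setU _ _); apply/pred0P => x /=.
apply/negP => /andP[xi]; rewrite in_bigcup_seq => /hasP[j js xj].
case/negP: nis; rewrite -(labelF i (mem_head _ _) x xi).
by rewrite (labelF j _ x xj) // inE js orbT.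
Qed.

Lemma in_opp_set (G : finZmodType) (B : {set G}) x : (x \in opp_set B) = (- x \in B).
Proof. by rewrite -{1}(opprK x) (mem_imset _ _ oppr_inj). Qed.

Lemma card_opp_set (G : finZmodType) (B : {set G}) : #|opp_set B| = #|B|.
Proof. exact: card_imset oppr_inj. Qed.

Lemma order_opp (G : finZmodType) (x : G) : #[- x]%g = #[x]%g.
Proof. exact: orderV. Qed.

Lemma mulrn_order (G : finZmodType) (x : G) : x *+ #[x]%g = 0.
Proof. by rewrite -FinRing.zmodXgE expg_order. Qed.

Section Partition.
Variables (G : finZmodType) (Sigma : {set G}) (k m n : nat).
Variables (A : {set G}) (R : nat -> {set G}) (Rw : {set G}).
Variables (Z : nat -> {set G}) (Zw : {set G}).
Hypothesis part : generator_partition Sigma k m n A R Rw Z Zw.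

(** [U] is closed under opposites and [V] has no opposite in [Sigma], so [U] yields the edges and
    [V] the arcs. *)
Let U := A :|: (\bigcup_(1 <= s < m.+1) (R s :|: opp_set (R s)))
           :|: (Rw :|: opp_set Rw).
Let V := (\bigcup_(2 <= t < n.+1) Z t) :|: Zw.

Lemma Sigma_split : Sigma = U :|: V.
Proof. by rewrite (gp_cover part) /U /V !setUA. Qed.

Lemma U_opp x : x \in U -> - x \in U.
Proof.
rewrite /U !in_setU !in_opp_set opprK.
case/orP => [/orP[xA|/in_bigcup_nat[s sP xs]]|]; last by rewrite orbC => ->; rewrite orbT.
  have <- : x = - x; last by rewrite xA.
  by apply/eqP; rewrite -addr_eq0 -mulr2n -(gp_A part xA) mulrn_order.
rewrite (_ : - x \in \bigcup_(1 <= s < m.+1) _) ?orbT //.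
apply/in_bigcup_nat; exists s => //; move: xs.
by rewrite !in_setU !in_opp_set opprK orbC.
Qed.

Lemma V_opp x : x \in V -> - x \notin Sigma.
Proof.
rewrite /V in_setU => /orP[/in_bigcup_nat[t tP xt]|/(gp_Zw part)[] //].
by have [] := gp_Z part tP xt.
Qed.

Lemma card_edges : (m <= k)%N -> #|[set a in Sigma | - a \in Sigma]| =
  (#|A| + \sum_(1 <= s < m.+1) 2 * #|R s| + 2 * #|Rw|)%N.
Proof.
move=> le_mk.
have -> : [set a in Sigma | - a \in Sigma] = U.
  apply/setP => x; rewrite inE; apply/andP/idP => [[]|xU].
    by rewrite {1}Sigma_split in_setU => /orP[//|/V_opp/negPf->].
  by rewrite Sigma_split; split; apply/setUP; left; rewrite ?U_opp.
have double (B : {set G}) : [disjoint B & opp_set B] -> #|B :|: opp_set B| = (2 * #|B|)%N.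
  by move=> dB; apply/eqP; rewrite mul2n -addnn -{2}(card_opp_set B) (leq_card_setU _ _).
have ordR s x : (1 <= s < m.+1)%N -> x \in R s :|: opp_set (R s) -> #[x]%g = (2 * s).+1.
  rewrite in_setU in_opp_set => sP /orP[/(gp_R part sP) //|/(gp_R part sP)].
  by rewrite order_opp.
rewrite /U; have /eqP -> : #|A :|: (\bigcup_(1 <= s < m.+1) (R s :|: opp_set (R s)))
           :|: (Rw :|: opp_set Rw)| ==
    (#|A :|: (\bigcup_(1 <= s < m.+1) (R s :|: opp_set (R s)))|
       + #|Rw :|: opp_set Rw|)%N.
  rewrite (leq_card_setU _ _); apply/pred0P => x /=; apply/negP.
  rewrite 2!in_setU in_opp_set => /andP[/orP[xA|/in_bigcup_nat[s sP xs]] xRw].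
    (* For k = 0 the orders do not separate [A] from [Rw]; an involution in [Rw] would however lie
       in [opp_set Rw] as well. *)
    have xN : - x = x.
      by apply/eqP; rewrite eq_sym -addr_eq0 -mulr2n -(gp_A part xA) mulrn_order.
    move: xRw; rewrite xN orbb => xRw; have /pred0P/(_ x) := gp_Rw_disjoint part.
    by rewrite /= in_opp_set xN xRw.
  (* Orders in the blocks [R s] are at most 2m + 1, hence at most 2k + 1. *)
  have : ((2 * k).+1 < #[x]%g)%N by case/orP: xRw => /(gp_Rw part) //; rewrite order_opp.
  by rewrite (ordR s x sP xs); lia.
rewrite double ?(gp_Rw_disjoint part) //; congr (_ + _)%N.
have /eqP -> : #|A :|: (\bigcup_(1 <= s < m.+1) (R s :|: opp_set (R s)))| ==
    (#|A| + #|(\bigcup_(1 <= s < m.+1) (R s :|: opp_set (R s)))|)%N.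
  rewrite (leq_card_setU _ _); apply/pred0P => x /=; apply/negP.
  move=> /andP[/(gp_A part) xA /in_bigcup_nat[s sP xs]].
  by have := ordR s x sP xs; rewrite xA; lia.
congr (_ + _)%N; rewrite (@card_bigcup_label _ _ _ _ (fun x => #[x]%g./2)) ?iota_uniq //.
  by apply: eq_big_nat => s sP; rewrite double // (gp_R_disjoint part).
move=> s; rewrite mem_index_iota => sP x xs.
by rewrite (ordR s x sP xs) mul2n -[_.+1]/(true + _)%N half_bit_double.
Qed.

Lemma card_arcs : (n <= k)%N -> #|[set a in Sigma | - a \notin Sigma]| =
  (\sum_(2 <= t < n.+1) #|Z t| + #|Zw|)%N.
Proof.
move=> le_nk.
have -> : [set a in Sigma | - a \notin Sigma] = V.
  apply/setP => x; rewrite inE; apply/andP/idP => [[]|xV].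
    rewrite {1}Sigma_split in_setU => /orP[/U_opp xU|//].
    by rewrite Sigma_split in_setU xU.
  by rewrite V_opp // Sigma_split in_setU xV orbT.
rewrite /V -(@card_bigcup_label _ _ _ _ (fun x => #[x]%g.-1)) ?iota_uniq //.
  apply/eqP; rewrite (leq_card_setU _ _); apply/pred0P => x /=; apply/negP.
  move=> /andP[/in_bigcup_nat[t tP xt] /(gp_Zw part)[+ _]].
  by have [-> _] := gp_Z part tP xt; lia.
move=> t; rewrite mem_index_iota => tP x xt.
by have [-> _] := gp_Z part tP xt.
Qed.

End Partition.

(** * Assembling the bound *)

Lemma covers_ffun_set (G : finZmodType) (B : {set G}) r (X : Type)
    (phi : G -> X -> G) (cost : X -> nat) (S : G -> G -> Prop) : #|B| = r ->
  {in B, forall a, covers (phi a) cost (S a)} ->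
  covers (fun x : {ffun 'I_r -> X} => \sum_(i < r) phi (nth 0 (enum B) i) (x i))
    (fun x => \sum_i cost (x i))%N (fun b => exists2 a, a \in B & S a b).
Proof.
move=> <- covB; have inB (i : 'I_#|B|) : nth 0 (enum B) i \in B.
  by rewrite -mem_enum mem_nth // -cardE.
apply: covers_sub (covers_dffun (fun i => covB _ (inB i))) => b [a aB Sab].
have lt_a : (index a (enum B) < #|B|)%N by rewrite cardE index_mem mem_enum.
by exists (Ordinal lt_a); rewrite /= nth_index ?mem_enum.
Qed.

(** The group is the union, over codes [x] of cost at most [k], of the balls of radius [k - cost x]
    translated by [phi x]. *)
Lemma card_covers (G : finZmodType) (X : finType) (phi : X -> G) cost S
    (L P : seq G) (k : nat) :
  covers phi cost S ->
  (forall g, exists w, [/\ (size w <= k)%N,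
     {in w, forall c, S c \/ [|| c \in L, - c \in L | c \in P]} &
     g = \sum_(c <- w) c]) ->
  (#|G| <= \sum_(x | cost x <= k) \sum_(i < (size L).+1)
     'C(size L, i) * 2 ^ i * 'C(size P + (k - cost x), i + size P))%N.
Proof.
move=> cov words_k; rewrite -cardsT.
apply: (@leq_trans #|\bigcup_(x | (cost x <= k)%N)
                       [set phi x + y | y in ball L P (k - cost x)]|).
  apply/subset_leq_card/subsetP => g _.
  have [w [sw wS ->]] := words_k g; have [x cx gx] := covers_ball cov wS.
  apply/bigcupP; exists x; first exact: leq_trans sw.
  apply/imsetP; exists (\sum_(c <- w) c - phi x); last by rewrite addrC subrK.
  by apply: ball_mono gx; rewrite leq_sub2r.
apply: leq_trans (leq_card_bigcup _ _) _; apply: leq_sum => x _.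
by rewrite card_imset ?card_ball //; apply: addrI.
Qed.

Lemma binz_natE z k c b : (c <= k)%N ->
  binz (z%:Z + k%:Z - c%:Z) b = 'C(z + (k - c), b).
Proof.
move=> le_ck; have -> : z%:Z + k%:Z - c%:Z = Posz (z + (k - c)) by lia.
by [].
Qed.

Local Close Scope ring_scope.

Theorem theorem2p1 (G : finZmodType) (Sigma : {set G})
    (k m n ra rw zw : nat) (r z : nat -> nat)
    (A : {set G}) (R : nat -> {set G}) (Rw : {set G})
    (Z : nat -> {set G}) (Zw : {set G})
    (le_mk : m <= k) (le_nk : n <= k)
    (gen_Sigma : <<Sigma>>%g = [set: G])
    (part_Sigma : generator_partition Sigma k m n A R Rw Z Zw)
    (card_A : #|A| = ra)
    (card_R : forall s, 1 <= s <= m -> #|R s| = r s)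
    (card_Rw : #|Rw| = rw)
    (card_Z : forall t, 2 <= t <= n -> #|Z t| = z t)
    (card_Zw : #|Zw| = zw) :
  [/\ (forall g : G, undirected_degree (Cay Sigma) g =
         ra + \sum_(1 <= s < m.+1) 2 * r s + 2 * rw),
      (forall g : G, directed_outdegree (Cay Sigma) g =
         \sum_(2 <= t < n.+1) z t + zw)
    & diameter (Cay Sigma) <= k ->
      #|G| <=
        \sum_(ia < ra.+1) \sum_(iw < rw.+1)
          ('C(ra, ia) * 'C(rw, iw) * 2 ^ iw *
           \sum_(sigma : families 1 m r | admissible sigma)
             ((\prod_(s < m.+1 - 1)
                 (multinomial (r (1 + s)) (entry sigma (i := s)) *
                  2 ^ row_sum sigma s)) *
              \sum_(tau : families 2 n z | admissible tau)
                ((\prod_(h < n.+1 - 2)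
                    multinomial (z (2 + h)) (entry tau (i := h))) *
                 binz (zw%:Z + k%:Z - ia%:Z
                         - (weight sigma)%:Z - (weight tau)%:Z)%R
                      (iw + zw))))].

Proof.
split=> [g|g|diam_k].
- rewrite undirected_degreeE (card_edges part_Sigma le_mk) card_A card_Rw.
  by congr (_ + _ + _); apply: eq_big_nat => s sP; rewrite card_R.
- rewrite directed_outdegreeE (card_arcs part_Sigma le_nk) card_Zw.
  by congr (_ + _); apply: eq_big_nat => t tP; rewrite card_Z.
have covA : covers (fun x : {ffun 'I_ra -> bool} =>
      \sum_(i < ra) nth 0 (enum A) i *+ x i)%R (fun x => \sum_i x i)
    (fun b => exists2 a, a \in A & a = b).
  apply: (@covers_ffun_set G A ra _ (fun a (b : bool) => a *+ b)%R _ eq card_A).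
  move=> a aA; apply: covers_involution.
  by rewrite -(gp_A part_Sigma aA) mulrn_order.
have covR : covers (fun x : {dffun forall i : 'I_(m.+1 - 1),
        {ffun 'I_(r (1 + i)) -> option ('I_(1 + i) * bool)}} =>
      (\sum_(i < m.+1 - 1) \sum_(u < r (1 + i)%N)
          signed_value (nth 0 (enum (R (1 + i)%N)) u) (x i u))%R)
    (fun x => \sum_i \sum_u code_cost (x i u))
    (fun b => exists i : 'I_(m.+1 - 1),
       exists2 a, a \in R (1 + i)%N & b = a \/ b = (- a)%R).
  apply: (@covers_dffun G 'I_(m.+1 - 1)
    (fun i => {ffun 'I_(r (1 + i)) -> option ('I_(1 + i) * bool)})
    (fun i y => \sum_(u < r (1 + i)%N)
       signed_value (nth 0 (enum (R (1 + i)%N)) u) (y u))%R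
    (fun i y => \sum_u code_cost (y u))
    (fun i b => exists2 a, a \in R (1 + i)%N & b = a \/ b = (- a)%R)) => i.
  have iP : 1 <= 1 + i <= m by have := ltn_ord i; lia.
  apply: (@covers_ffun_set G _ _ _ (fun a => @signed_value G a (1 + i)%N) _
    (fun a b => b = a \/ b = (- a)%R) (card_R _ iP)) => a aR.
  apply: covers_signed => //.
  by rewrite -(gp_R part_Sigma iP aR) mulrn_order.
have covZ : covers (fun x : {dffun forall i : 'I_(n.+1 - 2),
        {ffun 'I_(z (2 + i)) -> option ('I_(2 + i) * unit)}} =>
      (\sum_(i < n.+1 - 2) \sum_(u < z (2 + i)%N)
          cyclic_value (nth 0 (enum (Z (2 + i)%N)) u) (x i u))%R)
    (fun x => \sum_i \sum_u code_cost (x i u))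
    (fun b => exists i : 'I_(n.+1 - 2), exists2 a, a \in Z (2 + i)%N & a = b).
  apply: (@covers_dffun G 'I_(n.+1 - 2)
    (fun i => {ffun 'I_(z (2 + i)) -> option ('I_(2 + i) * unit)})
    (fun i y => \sum_(u < z (2 + i)%N)
       cyclic_value (nth 0 (enum (Z (2 + i)%N)) u) (y u))%R
    (fun i y => \sum_u code_cost (y u))
    (fun i b => exists2 a, a \in Z (2 + i)%N & a = b)) => i.
  have iP : 2 <= 2 + i <= n by have := ltn_ord i; lia.
  apply: (@covers_ffun_set G _ _ _ (fun a => @cyclic_value G a (2 + i)%N) _ eq
    (card_Z _ iP)) => a aZ.
  apply: covers_cyclic => //.
  by have [<- _] := gp_Z part_Sigma iP aZ; rewrite mulrn_order.
have := card_covers (L := enum Rw) (P := enum Zw) (k := k)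
          (covers_prod (covers_prod covA covR) covZ).
rewrite -!cardE card_Rw card_Zw => bound.
apply: leq_trans (bound _) _ => [g|] {bound}.
  have [w [sw wS gE]] := diameter_word g gen_Sigma diam_k.
  (* Letters of [A], [R s] and [Z t] go to the code, at row s - 1 or t - 2; letters of [Rw], their
     opposites and [Zw] go to the ball. *)
  exists w; split=> // c /wS; rewrite (gp_cover part_Sigma) !in_setU !mem_enum.
  case/orP => [/orP[/orP[/orP[cA|]|]|]|->]; last by rewrite !orbT; right.
  - by left; left; left; exists c.
  - case/in_bigcup_nat => s sP; rewrite in_setU in_opp_set => cR.
    have lt_s : s.-1 < m.+1 - 1 by lia.
    left; left; right; exists (Ordinal lt_s) => /=; rewrite add1n prednK; last by lia.
    by case/orP: cR => cR; [exists c; [|left] | exists (- c)%R; [|right; rewrite opprK]].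
  - by rewrite in_opp_set => /orP[]->; rewrite ?orbT; right.
  case/in_bigcup_nat => t tP cZ.
  have lt_t : t - 2 < n.+1 - 2 by lia.
  by left; right; exists (Ordinal lt_t) => /=; exists c; rewrite // subnKC //; lia.
pose F c := \sum_(i < rw.+1) 'C(rw, i) * 2 ^ i * binz (zw%:Z + k%:Z - c%:Z)%R (i + zw).
apply: (@leq_trans (\sum_(ia < ra.+1) 'C(ra, ia) *
  \sum_(sigma : families 1 m r | admissible sigma)
    (\prod_(s < m.+1 - 1) (multinomial (r (1 + s)) (entry sigma (i := s)) *
                  #|{: bool}| ^ row_sum sigma s)) *
  \sum_(tau : families 2 n z | admissible tau)
    (\prod_(h < n.+1 - 2) (multinomial (z (2 + h)) (entry tau (i := h)) *
                  #|{: unit}| ^ row_sum tau h)) * F (ia + weight sigma + weight tau))).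
  (* The sums over families and over [ia] are turned back into sums over codes. Dropping the
     condition that the cost is at most [k] only adds nonnegative terms. *)
  under [X in _ <= X]eq_bigr => ia _.
    rewrite -(@sum_families bool 1 m r (fun c =>
      \sum_(tau : families 2 n z | admissible tau)
      (\prod_(h < n.+1 - 2) (multinomial (z (2 + h)) (entry tau (i := h)) *
         #|{: unit}| ^ row_sum tau h)) * F (ia + c + weight tau))).
    under [X in _ * X]eq_bigr => x _ do
      rewrite -(@sum_families unit 2 n z (fun c => F (ia + _ + c))).
    over.
  rewrite -(@sum_ffun_bool ra (fun ia => \sum_x \sum_y F (ia + _ + _))).
  rewrite !pair_big /= big_mkcond /=; apply: leq_sum => x _.
  by rewrite andbT; case: ifP => // le_k; rewrite binz_natE.
(* It remains to move the sum over [iw], hidden in [F], inside the sums over families. *)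
rewrite leq_sum // => ia _.
under [X in _ <= X]eq_bigr do rewrite -!mulnA.
rewrite -big_distrr /= leq_mul2l; apply/orP; right.
under [X in _ <= X]eq_bigr do rewrite mulnA big_distrr.
rewrite exchange_big /= leq_sum // => sigma _.
rewrite card_bool.
under [X in _ <= X]eq_bigr do rewrite mulnCA big_distrr.
rewrite -big_distrr leq_mul2l exchange_big /=; apply/orP; right.
rewrite leq_sum // => tau _; rewrite /F.
under [X in _ <= X]eq_bigr do rewrite mulnCA.
rewrite -big_distrr /=; apply: leq_mul.
  (* One-way generators have a single sign, so their sign factor is 1. *)
  by apply: leq_prod => h _; rewrite card_unit exp1n muln1.
by apply: leq_sum => i _; rewrite !PoszD !opprD !addrA.
Qed.
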